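(* Let $\mathcal{T}=(t_{ijkl})$ be a real $4$th-order $n$-dimensional symmetric tensor. Then $\mathcal{T}$ is strictly copositive if and only if both of the following hold: (1) whenever $x\in\mathbb{R}^n_+$ and $\mathcal{T}x^4=0$, one has $x=0$; (2) there exists $y\in\mathbb{R}^n_+\setminus\{0\}$ such that $\mathcal{T}y^4>0$.
   Context: A real $4$th-order $n$-dimensional tensor $\mathcal{T}=(t_{ijkl})$, $1\le i,j,k,l\le n$, is symmetric if its entries are invariant under all permutations of the indices. For $x\in\mathbb{R}^n$, $\mathcal{T}x^4=\sum_{i,j,k,l=1}^n t_{ijkl}x_ix_jx_kx_l$. $\mathbb{R}^n_+$ is the set of vectors in $\mathbb{R}^n$ with all coordinates nonnegative. $\mathcal{T}$ is strictly copositive if $\mathcal{T}x^4>0$ for all $x\in\mathbb{R}^n_+\setminus\{0\}$. *)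

(* Defs.v *)
From mathcomp Require Import all_boot all_order all_fingroup all_algebra.
From mathcomp Require Import reals.

Set Implicit Arguments.
Unset Strict Implicit.
Unset Printing Implicit Defensive.

Import Order.TTheory GRing.Theory Num.Theory.
Local Open Scope ring_scope.

Definition tensor4 (R : realType) (n : nat) : Type :=
  'I_n -> 'I_n -> 'I_n -> 'I_n -> R.

(* The four indices form a family [i] on ['I_4], on which ['S_4] acts. *)
Definition symmetric_tensor4 (R : realType) (n : nat) (T : tensor4 R n) : Prop :=
  forall (s : 'S_4) (i : 'I_4 -> 'I_n),
    T (i (s 0)) (i (s 1)) (i (s 2)) (i (s 3)) = T (i 0) (i 1) (i 2) (i 3).

Definition tensor4_form (R : realType) (n : nat) (T : tensor4 R n)
    (x : 'cV[R]_n) : R :=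
  \sum_(i < n) \sum_(j < n) \sum_(k < n) \sum_(l < n)
    T i j k l * x i 0 * x j 0 * x k 0 * x l 0.

Definition nonneg_vec (R : realType) (n : nat) (x : 'cV[R]_n) : Prop :=
  forall i : 'I_n, 0 <= x i 0.

Definition strictly_copositive (R : realType) (n : nat) (T : tensor4 R n) : Prop :=
  forall x : 'cV[R]_n, nonneg_vec x -> x <> 0 -> 0 < tensor4_form T x.

(* Main.v *)
(** If the form were nonpositive at some nonzero [x] of the orthant, then along
    the segment from [x] to [y] it would vanish at some point, by the intermediate
    value theorem for polynomials in one variable. That point lies in the orthant,
    so it is [0] by (1); but a segment between two nonzero nonnegative vectors
    avoids [0]. *)
Require Import Defs.
From mathcomp Require Import all_boot all_order all_fingroup all_algebra.
From mathcomp Require Import reals.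

Set Implicit Arguments.
Unset Strict Implicit.
Unset Printing Implicit Defensive.

Import Order.TTheory GRing.Theory Num.Theory.
Local Open Scope ring_scope.

(** Each coordinate is affine in [t] along the line, so the form restricts to a polynomial, to which
    [poly_ivt] applies. *)
Lemma tensor4_form_line_poly (R : realType) (n : nat) (T : tensor4 R n)
    (u v : 'cV[R]_n) :
  exists p : {poly R}, forall t : R, p.[t] = tensor4_form T (u + t *: v).
Proof.
pose q i : {poly R} := (u i 0)%:P + 'X * (v i 0)%:P.
exists (\sum_(i < n) \sum_(j < n) \sum_(k < n) \sum_(l < n)
  (T i j k l)%:P * q i * q j * q k * q l) => t.
do 4![rewrite horner_sum; apply: eq_bigr => ? _].
by rewrite !hornerE !mxE.
Qed.

(** A vanishing sum of nonnegative terms has only zero terms, and [1 - t] and [t] are not both zero: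
    [x] vanishes if [t = 0], and [y] otherwise. *)
Lemma nonneg_vec_segment_neq0 (R : realType) (n : nat) (x y : 'cV[R]_n) (t : R) :
  nonneg_vec x -> nonneg_vec y -> x <> 0 -> y <> 0 -> 0 <= t <= 1 ->
  (1 - t) *: x + t *: y <> 0.
Proof.
move=> x0 y0 nx ny /andP[t0 t1] z0.
have s0 : 0 <= 1 - t by rewrite subr_ge0.
have terms0 i : (1 - t) * x i 0 = 0 /\ t * y i 0 = 0.
  have /eqP := congr1 (fun z : 'cV_n => z i 0) z0.
  rewrite !mxE paddr_eq0 ?mulr_ge0 //.
  by move=> /andP[/eqP ? /eqP ?].
have [t00|tN0] := eqVneq t 0.
  apply: nx; apply/colP => i; have [+ _] := terms0 i.
  by rewrite t00 subr0 mul1r mxE.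
apply: ny; apply/colP => i; have [_ /eqP] := terms0 i.
by rewrite mulf_eq0 (negbTE tN0) mxE => /eqP.
Qed.

Theorem theorem3p1 (R : realType) (n : nat) (hn : (0 < n)%N)
    (T : tensor4 R n) (hT : symmetric_tensor4 T) :
  strictly_copositive T <->
  (forall x : 'cV[R]_n, nonneg_vec x -> tensor4_form T x = 0 -> x = 0) /\
  (exists y : 'cV[R]_n, [/\ nonneg_vec y, y <> 0 & 0 < tensor4_form T y]).
Proof.
split=> [Tpos | [Tdef [y [y0 ny Ty]]] x x0 nx].
  split=> [x x0 Tx0|].
    by apply/eqP/negPn/negP => /eqP /(Tpos x x0); rewrite Tx0 ltxx.
  (* The all-ones vector serves as [y]; it is nonzero because [0 < n]. *)
  have one_ge0 : nonneg_vec (const_mx 1 : 'cV[R]_n) by move=> i; rewrite mxE.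
  have one_neq0 : const_mx 1 <> 0 :> 'cV[R]_n.
    by move=> /colP /(_ (Ordinal hn)) /eqP; rewrite !mxE oner_eq0.
  by exists (const_mx 1); split=> //; exact: Tpos.
rewrite ltNge; apply/negP => Tx.
have [p pE] := tensor4_form_line_poly T x (y - x).
have p01 : p.[0] <= 0 <= p.[1].
  by rewrite !pE scale0r addr0 scale1r subrKC Tx ltW.
have [t t01 /rootP] := poly_ivt ler01 p01.
(* As a convex combination, the point [x + t *: (y - x)] visibly lies in the orthant. *)
have -> : p.[t] = tensor4_form T ((1 - t) *: x + t *: y).
  by rewrite pE scalerBr scalerBl scale1r addrCA addrC.
have z_ge0 : nonneg_vec ((1 - t) *: x + t *: y).
  move: t01 => /andP[t0 t1] i.
  by rewrite !mxE addr_ge0 ?mulr_ge0 ?subr_ge0.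
by move=> /(Tdef _ z_ge0); exact: nonneg_vec_segment_neq0.
Qed.
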